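(* For every $n\ge1$ there is a bijection $\phi_F:\mathcal{FL}^{(B)}_n\cup\mathcal{FL}^{(D)}_n\to\mathcal{T}^\circ_n\cup\mathcal{T}^*_n$ which, for each $1\le k\le n$, restricts to a bijection from $\mathcal{FL}^{(B)}_{n,k}$ onto $\mathcal{T}^\circ_{n,k}$ and to a bijection from $\mathcal{FL}^{(D)}_{n,k}$ onto $\mathcal{T}^*_{n,k}$.
   Context: Signed permutations of $[n]$ in window notation $\sigma=\sigma_1\cdots\sigma_n$ (entries in $\{\pm1,\dots,\pm n\}$, absolute values a permutation of $[n]$). For $1\le k\le n$, $\sigma_k\cdots\sigma_1\sigma_{k+1}\cdots\sigma_n$ is a flip of $\sigma$ if $k=n$ or $|\sigma_{k+1}|<\min\{|\sigma_i|:i\le k\}$; flip equivalence is the equivalence relation generated by flips, with classes $[\sigma]$. Signed maximum: for a nonempty word $\sigma$ of nonzero integers with distinct absolute values, write $\sigma=\sigma_L\hat\sigma\sigma_R$ with $|\hat\sigma|=\min|\sigma|$; (1) if $\sigma_L,\sigma_R$ empty, $\mathsf{smax}(\sigma)=\hat\sigma$; (2) if only $\sigma_L$ is empty: $\hat\sigma$ if $\hat\sigma>0$, else $\mathsf{smax}(\sigma_R)$; (3) if only $\sigma_R$ is empty: $\hat\sigma$ if $\hat\sigma>0$, else $\mathsf{smax}(\sigma_L)$; (4) both nonempty, $\hat\sigma>0$: $\mathsf{smax}(\sigma_L)$ if $\min|\sigma_L|>\min|\sigma_R|$, else $\mathsf{smax}(\sigma_R)$; (5) both nonempty, $\hat\sigma<0$: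 $\mathsf{smax}(\sigma_L)$ if $\min|\sigma_L|<\min|\sigma_R|$, else $\mathsf{smax}(\sigma_R)$. It is constant on flip classes. $\mathcal{FL}^{(B)}_n$ ($\mathcal{FL}^{(D)}_n$): classes with positive (negative) signed maximum; $\mathcal{FL}^{(B)}_{n,k}$: $\mathsf{smax}=k$; $\mathcal{FL}^{(D)}_{n,k}$: $\mathsf{smax}=-k$. $\mathcal{T}_n$: complete increasing binary trees with $n$ labelled nodes — plane rooted trees in which every node is a leaf or has two ordered children (left, right), exactly $n$ nodes labelled bijectively by $[n]$, all non-leaf nodes labelled (leaves labelled or empty), labels increasing from the root. Rightmost path $(v_1,\dots,v_d)$: $v_1$ the root, $v_{i+1}$ the right child of $v_i$, $v_d$ a leaf. $\mathcal{T}^\circ_n$ ($\mathcal{T}^*_n$): $v_d$ empty (labelled). Rightmost label: label of $v_{d-1}$ if $\tau\in\mathcal{T}^\circ_n$, of $v_d$ if $\tau\in\mathcal{T}^*_n$. $\mathcal{T}^\circ_{n,k}$, $\mathcal{T}^*_{n,k}$: rightmost label $k$. *)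

(* Defs.v *)
From Stdlib Require Import Relation_Operators.
From mathcomp Require Import all_boot all_order all_algebra.
From mathcomp Require Import boolp classical_sets functions zify.

Set Implicit Arguments.
Unset Strict Implicit.
Unset Printing Implicit Defensive.

Local Open Scope nat_scope.
Local Open Scope classical_set_scope.

Implicit Types (w u v L R : seq int) (h x y : int) (n k m : nat).

Definition abs_word w : seq nat := [seq `|x|%N | x : int <- w].

Definition signed_perm n w : Prop := perm_eq (abs_word w) (iota 1 n).

(* The minimum of the absolute values; 0 for the empty word. *)
Definition minabs w : nat :=
  foldr minn (head 0 (abs_word w)) (abs_word w).

(* [w = take (imin w) w ++ nth 0 w (imin w) :: drop (imin w).+1 w] is the
   decomposition of [w] around its letter of least absolute value. *)
Definition imin w : nat := index (minabs w) (abs_word w).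

(* Letters are numbered from 0: the letter following the prefix of length [k]
   is [nth 0 w k]. *)
Definition flip w v : Prop :=
  exists k, [/\ 1 <= k <= size w,
    k = size w \/ `|nth 0%R w k|%N < minabs (take k w) &
    v = rev (take k w) ++ drop k w].

Definition flip_equiv : seq int -> seq int -> Prop := clos_refl_sym_trans _ flip.

Definition flip_class w : set (seq int) := [set v | flip_equiv w v].

Definition smax_step (f : seq int -> int) L h R : int :=
  match L, R with
  | [::], [::] => h
  | [::], _ => if (0 < h)%R then h else f R
  | _, [::] => if (0 < h)%R then h else f L
  | _, _ => if (0 < h)%R
            then (if minabs R < minabs L then f L else f R)
            else (if minabs L < minabs R then f L else f R)
  end.

(* [m] bounds the recursion depth. *)
Fixpoint smax_rec m w : int :=
  if m is m'.+1 then
    let i := imin w in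
    smax_step (smax_rec m') (take i w) (nth 0%R w i) (drop i.+1 w)
  else 0%R.

Definition smax w : int := smax_rec (size w) w.

Arguments smax : simpl never.
Arguments minabs : simpl never.

Definition FLB n : set (set (seq int)) :=
  [set flip_class w | w in [set w | signed_perm n w /\ (0 < smax w)%R]].
Definition FLD n : set (set (seq int)) :=
  [set flip_class w | w in [set w | signed_perm n w /\ (smax w < 0)%R]].
Definition FLBk n k : set (set (seq int)) :=
  [set flip_class w | w in [set w | signed_perm n w /\ smax w = k%:Z%R]].
Definition FLDk n k : set (set (seq int)) :=
  [set flip_class w | w in [set w | signed_perm n w /\ smax w = (- k%:Z)%R]].

Inductive btree : Type :=
| EmptyLeaf
| LabelledLeaf (a : nat)
| Node (a : nat) (l r : btree).

Fixpoint labels (t : btree) : seq nat :=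
  match t with
  | EmptyLeaf => [::]
  | LabelledLeaf a => [:: a]
  | Node a l r => a :: labels l ++ labels r
  end.

Fixpoint increasing (t : btree) : bool :=
  if t is Node a l r then
    [&& all (ltn a) (labels l ++ labels r), increasing l & increasing r]
  else true.

(* The labels of v_1, ..., v_d, with [None] for an empty leaf. *)
Fixpoint rightmost_path (t : btree) : seq (option nat) :=
  match t with
  | EmptyLeaf => [:: None]
  | LabelledLeaf a => [:: Some a]
  | Node a _ r => Some a :: rightmost_path r
  end.

Definition v_last (t : btree) : option nat :=
  let p := rightmost_path t in nth None p (size p).-1.

Definition v_penultimate (t : btree) : option nat :=
  let p := rightmost_path t in nth None p (size p).-2.

Definition Tree n : set btree :=
  [set t | perm_eq (labels t) (iota 1 n) /\ increasing t].
Definition Tcirc n : set btree := Tree n `&` [set t | v_last t = None].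
Definition Tstar n : set btree := Tree n `&` [set t | exists a, v_last t = Some a].
Definition Tcirck n k : set btree :=
  Tcirc n `&` [set t | v_penultimate t = Some k].
Definition Tstark n k : set btree := Tstar n `&` [set t | v_last t = Some k].

(* The signed maximum is constant on flip classes of words with letters of
   distinct absolute values ([smax_flip_class]), so that the sets of classes
   above do not depend on the choice of representatives. *)

Lemma minabs_le w x : x \in w -> minabs w <= `|x|%N.
Proof.
rewrite /minabs => xw.
have : `|x|%N \in abs_word w by apply: (map_f absz).
elim: (abs_word w) (head _ _) => // b s IH c.
rewrite inE /= => /orP[/eqP->|/(IH c)]; lia.
Qed.

Lemma minabs_mem w : w != [::] -> minabs w \in abs_word w.
Proof.
case: w => // a w _; rewrite /minabs /=.
have H s c : foldr minn c s \in c :: s.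
  elim: s => [|b s IH]; first by rewrite mem_seq1.
  rewrite /= /minn !inE; case: ifP => _; first by rewrite eqxx orbT.
  by move: IH; rewrite inE => /orP[->//|->]; rewrite !orbT.
have := H (abs_word w) `|a|%N.
rewrite /minn inE; case: ifP => _; first by rewrite mem_head.
by rewrite inE.
Qed.

Lemma minabs_perm w v : perm_eq w v -> minabs w = minabs v.
Proof.
move=> wv; have [w0|wn0] := eqVneq w [::].
  by move: wv; rewrite w0 perm_sym => /perm_nilP ->.
have vn0 : v != [::].
  by apply: contra_neq wn0 => v0; apply/perm_nilP; rewrite -v0.
have /mapP[x xw ex] := minabs_mem wn0; have /mapP[y yv ey] := minabs_mem vn0.
have := @minabs_le v x; have := @minabs_le w y.
rewrite -(perm_mem wv) xw (perm_mem wv) yv -ex -ey => /(_ isT) A /(_ isT) B.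
by apply/eqP; rewrite eqn_leq A B.
Qed.

Lemma imin_lt w : w != [::] -> imin w < size w.
Proof. by move=> /minabs_mem; rewrite -index_mem size_map. Qed.

Lemma smax_step_eq f g L h R :
  f L = g L -> f R = g R -> smax_step f L h R = smax_step g L h R.
Proof. by rewrite /smax_step; case: L => [|a s]; case: R => [|b t] eL eR //; rewrite ?eL ?eR. Qed.

Lemma smax_rec_fuel m m' w :
  size w <= m -> size w <= m' -> smax_rec m w = smax_rec m' w.
Proof.
elim: m m' w => [|m IH] [|m'] [|a w] //= sm sm'.
have lt := imin_lt (isT : a :: w != [::]).
apply: smax_step_eq; apply: IH;
  rewrite ?size_take ?size_drop /= in lt *; try case: ifP; move: lt sm sm'; lia.
Qed.

Lemma imin_cat L h R :
  all (fun x => `|h|%N < `|x|%N) (L ++ R) -> imin (L ++ h :: R) = size L.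
Proof.
move=> H; have -> : minabs (L ++ h :: R) = `|h|%N -> imin (L ++ h :: R) = size L.
- rewrite /imin => ->; rewrite /abs_word map_cat index_cat /= eqxx addn0 size_map.
  case: ifP => // /mapP[x xL e]; move/allP: H => /(_ x).
  by rewrite mem_cat xL e ltnn => /(_ isT).
- by [].
have n0 : L ++ h :: R != [::] by case: (L).
have /mapP[x xw e] := minabs_mem n0.
have := @minabs_le (L ++ h :: R) h; rewrite mem_cat mem_head orbT => /(_ isT).
move/allP: H => /(_ x); rewrite e; move: xw; rewrite !mem_cat inE orbCA.
by case/orP=> [/eqP-> //|->] /(_ isT); lia.
Qed.

Lemma smax_cat L h R :
  all (fun x => `|h|%N < `|x|%N) (L ++ R) ->
  smax (L ++ h :: R) = smax_step smax L h R.
Proof.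
move=> H; rewrite {1}/smax size_cat addnS /= imin_cat //.
rewrite take_size_cat // nth_cat ltnn subnn /= -cat_rcons.
rewrite drop_size_cat ?size_rcons //.
by apply: smax_step_eq; apply: smax_rec_fuel; rewrite ?leq_addr ?leq_addl.
Qed.

Lemma min_split w : uniq (abs_word w) -> w != [::] ->
  exists L h R, w = L ++ h :: R /\ all (fun x => `|h|%N < `|x|%N) (L ++ R).
Proof.
move=> uw wn0; have /mapP[h hw e] := minabs_mem wn0.
case/splitPr: hw uw e => L R uw e; exists L, h, R; split=> //.
apply/allP => x xLR; have := @minabs_le (L ++ h :: R) x.
have xw : x \in L ++ h :: R by rewrite mem_cat inE orbCA -mem_cat xLR orbT.
rewrite xw e => /(_ isT); rewrite leq_eqVlt => /orP[/eqP e'|//].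
have p : perm_eq (L ++ h :: R) (h :: L ++ R).
  by rewrite -[h :: R]cat1s perm_catCA.
move: uw; rewrite (perm_uniq (perm_map absz p)) /= e' => /andP[/negP[]].
exact: (map_f absz).
Qed.

Lemma smax_rev w : uniq (abs_word w) -> smax (rev w) = smax w.
Proof.
have [m] := ubnP (size w); elim: m w => // m IH w lt uw.
have [->//|wn0] := eqVneq w [::].
have [L [h [R [ew H]]]] := min_split uw wn0; rewrite {}ew in lt uw *.
have HR : all (fun x => `|h|%N < `|x|%N) (rev R ++ rev L).
  by rewrite -rev_cat all_rev.
move: uw; rewrite /abs_word map_cat cat_uniq map_cons.
rewrite /= negb_or => /and3P[uL /andP[_ dLR] /andP[_ uR]].
have szL : size L < m by move: lt; rewrite size_cat /=; lia.
have szR : size R < m by move: lt; rewrite size_cat /=; lia.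
rewrite rev_cat rev_cons cat_rcons !smax_cat //.
have ne : L != [::] -> R != [::] -> minabs L != minabs R.
  move=> /minabs_mem mL /minabs_mem mR; apply/eqP => e.
  by move/hasPn: dLR => /(_ _ mR) /negP; apply; rewrite -e.
have pr u : minabs (rev u) = minabs u by apply: minabs_perm; rewrite perm_rev.
have sr (u : seq int) : rev u = [::] -> u = [::].
  by move/(congr1 size); rewrite size_rev => /size0nil.
have := IH L szL uL; have := IH R szR uR; have := pr L; have := pr R.
have := sr L; have := sr R.
case: L ne {H HR uL dLR szL lt} => [|a L] ne; case: R ne {uR szR} => [|b R] ne //=.
- by rewrite -[rev [::]]/[::]; case: (rev (b :: R)) => [/(_ erefl)//|c s] /= _ _ _ _ -> _.
- by case: (rev (a :: L)) => [_ /(_ erefl)//|c s] /= _ _ _ _ _ ->.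
have {ne} := ne isT isT.
case: (rev (a :: L)) => [_ _ /(_ erefl)//|c s].
case: (rev (b :: R)) => [_ /(_ erefl)//|d t] /= ne _ _ -> -> -> ->.
by case: ltngtP ne => //=; case: ifP.
Qed.

Lemma perm_flip w v : flip w v -> perm_eq w v.
Proof.
case=> k [_ _ ->]; rewrite -{1}(cat_take_drop k w) perm_cat2r.
by rewrite perm_sym perm_rev.
Qed.

Lemma smax_flip w v : uniq (abs_word w) -> flip w v -> smax v = smax w.
Proof.
have [m] := ubnP (size w); elim: m w v => // m IH w v lt uw [k [kw Hk ->]].
have [kE|kE] := eqVneq k (size w).
  by rewrite kE take_size drop_size cats0 smax_rev.
have {Hk} Hk : `|nth 0%R w k|%N < minabs (take k w).
  by case: Hk kE => // ->; rewrite eqxx.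
have wn0 : w != [::] by case: (w) kw => //=; lia.
have [L [h [R [ew H]]]] := min_split uw wn0; rewrite {}ew in lt uw kw kE Hk *.
have kL : k <= size L.
  rewrite leqNgt; apply/negP => Lk.
  have hin : h \in take k (L ++ h :: R).
    by rewrite take_cat ltnNge (ltnW Lk) /= -subnSK // mem_cat mem_head orbT.
  have := leq_trans Hk (minabs_le hin).
  have : nth 0%R (L ++ h :: R) k \in R.
    rewrite nth_cat ltnNge (ltnW Lk) /= -subnSK //= mem_nth //.
    by move: kw kE; rewrite size_cat /=; lia.
  move=> nR; move/allP: H => /(_ (nth 0%R (L ++ h :: R) k)).
  by rewrite mem_cat nR orbT => /(_ isT); lia.
have tk : take k (L ++ h :: R) = take k L by rewrite takel_cat.
have dk : drop k (L ++ h :: R) = drop k L ++ h :: R.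
  rewrite drop_cat; case: ltnP => // Lk.
  have -> : k = size L by lia.
  by rewrite subnn drop0 drop_size.
have uL : uniq (abs_word L).
  by move: uw; rewrite /abs_word map_cat cat_uniq => /and3P[].
rewrite tk dk catA.
set L' := rev _ ++ _.
have fL : flip L L'.
  exists k; split=> //; first by case/andP: kw => ->.
  have [->|kn] := eqVneq k (size L); [by left | right].
  have kL' : k < size L by rewrite ltn_neqAle kn.
  by move: Hk; rewrite tk nth_cat kL'.
have pL := perm_flip fL.
have eL : smax L' = smax L.
  by apply: IH => //; move: lt; rewrite size_cat /=; lia.
have H' : all (fun x => `|h|%N < `|x|%N) (L' ++ R).
  by rewrite (@all_cat _ _ L') -(perm_all _ pL) -all_cat.
rewrite !smax_cat //.
have := minabs_perm pL; have := perm_size pL; move: eL; rewrite /smax_step.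
case: (L) => [|a s]; case: (L') => [|b t] //= eL _ eM.
by rewrite eL eM; case: (R).
Qed.

Lemma smax_flip_equiv w v : uniq (abs_word w) -> flip_equiv w v -> smax v = smax w.
Proof.
have P (a b : seq int) : flip_equiv a b -> perm_eq a b.
  by elim=> // [x y /perm_flip //|x y _|x y z _ + _]; [rewrite perm_sym|apply: perm_trans].
move=> uw wv; elim: wv uw => {w v} [w v f u|//|w v f IH u|w v x f IHf g IHg u].
- exact: smax_flip.
- by rewrite IH //; have /(perm_map absz)/perm_uniq -> := P _ _ f.
- rewrite IHg ?IHf //.
  by have /(perm_map absz)/perm_uniq <- := P _ _ f.
Qed.

Lemma smax_flip_class n w v : signed_perm n w -> flip_class w v -> smax v = smax w.
Proof.
move=> sw; apply: smax_flip_equiv.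
by rewrite (perm_uniq sw) iota_uniq.
Qed.

(* Main.v *)
Require Import Defs.
From Stdlib Require Import Relation_Operators.
From mathcomp Require Import all_boot all_order all_algebra.
From mathcomp Require Import boolp classical_sets functions.
From mathcomp Require Import zify.

(* If [h] is the letter of least absolute value of [w = L h R], every flip of
   [w] is either a flip of [L] or the reversal of [w].  Hence the class of [w]
   amounts to [h] together with the unordered pair of the classes of [L] and
   [R].  The tree of [w] has root [|h|] and the trees of [L] and [R] as
   subtrees; the sign of [h] is encoded by their order, the subtree that carries
   the signed maximum (the empty one, if this maximum is [h]) being put on the
   right.  A singleton is either an empty
   pair of subtrees or a labelled leaf, according to its sign. *)

Import GRing.Theory Num.Theory.

Local Open Scope nat_scope.
Local Open Scope classical_set_scope.

(** * Induction on words and flips around the least letter *)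

Lemma minimal_letter_ind (P : seq int -> Prop) :
  P [::] ->
  (forall L h R, uniq (abs_word (L ++ R)) -> h != 0%R ->
     all (fun x => `|h|%N < `|x|%N) (L ++ R) -> P L -> P R ->
     P (L ++ h :: R)) ->
  forall w, uniq (abs_word w) -> 0%R \notin w -> P w.
Proof.
move=> P0 PS w; have [m] := ubnP (size w).
elim: m w => // m IH w lt uw nw.
have [->//|wn0] := eqVneq w [::].
have [L [h [R [ew H]]]] := min_split uw wn0; rewrite {}ew in lt uw nw *.
move: nw; rewrite mem_cat inE !negb_or eq_sym => /and3P[nL hn nR].
have uLR : uniq (abs_word (L ++ R)).
  move: uw; rewrite /abs_word !map_cat !cat_uniq /= negb_or.
  by case/and3P=> -> /andP[_ ->] /andP[_ ->].
move: (uLR); rewrite /abs_word map_cat cat_uniq => /and3P[uL _ uR].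
move: lt; rewrite size_cat /= => lt.
by apply: PS => //; apply: IH => //; lia.
Qed.

(** A proper prefix containing [h] cannot be reversed: the next letter would lie in [R] and exceed
    [h] in absolute value. So any flip other than the full reversal acts inside [L]. *)
Lemma flip_min_split L h R v :
  all (fun x => `|h|%N < `|x|%N) (L ++ R) -> flip (L ++ h :: R) v ->
  v = rev (L ++ h :: R) \/ exists2 L', flip L L' & v = L' ++ h :: R.
Proof.
move=> H [k [kw Hk ->]].
have [->|kE] := eqVneq k (size (L ++ h :: R)).
  by left; rewrite take_size drop_size cats0.
have {}Hk : `|nth 0%R (L ++ h :: R) k|%N < minabs (take k (L ++ h :: R)).
  by case: Hk kE => // ->; rewrite eqxx.
have kL : k <= size L.
  rewrite leqNgt; apply/negP => Lk.
  have hin : h \in take k (L ++ h :: R).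
    by rewrite take_cat ltnNge (ltnW Lk) /= -subnSK // mem_cat mem_head orbT.
  have := leq_trans Hk (minabs_le hin).
  have nR : nth 0%R (L ++ h :: R) k \in R.
    rewrite nth_cat ltnNge (ltnW Lk) /= -subnSK //= mem_nth //.
    by move: kw kE; rewrite size_cat /=; lia.
  move/allP: H => /(_ (nth 0%R (L ++ h :: R) k)).
  by rewrite mem_cat nR orbT => /(_ isT); lia.
right; exists (rev (take k L) ++ drop k L).
  exists k; split=> //; first by case/andP: kw => ->.
  (* For [k = size L] the next letter is [h] itself, and [L] is reversed entirely. *)
  have [->|kn] := eqVneq k (size L); [by left | right].
  have kL' : k < size L by rewrite ltn_neqAle kn.
  by move: Hk; rewrite takel_cat // nth_cat kL'.
rewrite -catA takel_cat // drop_cat; case: ltnP => // Lk.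
have -> : k = size L by lia.
by rewrite subnn drop0 drop_size.
Qed.

Lemma flip_rev w : w != [::] -> flip w (rev w).
Proof.
move=> wn0; exists (size w); split; last by rewrite take_size drop_size cats0.
  by rewrite leqnn andbT; case: (w) wn0.
by left.
Qed.

Lemma flip_equiv_rev w : flip_equiv w (rev w).
Proof.
have [->|wn0] := eqVneq w [::]; first exact: rst_refl.
exact/rst_step/flip_rev.
Qed.

Lemma flip_equiv_perm w v : flip_equiv w v -> perm_eq w v.
Proof.
elim=> // [x y /perm_flip //|x y _|x y z _ + _]; first by rewrite perm_sym.
exact: perm_trans.
Qed.

(** Reversing all of [L] is unconditional in [L]; in the longer word the next letter is then [h],
    which is small enough. *)
Lemma flip_cat L L' h R :
  all (fun x => `|h|%N < `|x|%N) L -> flip L L' ->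
  flip (L ++ h :: R) (L' ++ h :: R).
Proof.
move=> H [k [/andP[k0 kL] Hk ->]]; exists k; split.
- by rewrite k0 size_cat; apply: leq_trans kL (leq_addr _ _).
- right; rewrite takel_cat // nth_cat; case: (ltnP k (size L)) => [lt|ge].
    by case: Hk => // e; move: lt; rewrite e ltnn.
  have ek : k = size L by lia.
  rewrite ek subnn take_size /=.
  have Ln0 : L != [::] by case: (L) ek k0 => //= ->.
  by have /mapP[x xL ->] := minabs_mem Ln0; apply: (allP H).
- rewrite takel_cat // drop_cat; case: ltnP => Lk; first by rewrite catA.
  have -> : k = size L by lia.
  by rewrite subnn drop0 drop_size cats0.
Qed.

Lemma flip_equiv_catl L L' h R :
  all (fun x => `|h|%N < `|x|%N) L -> flip_equiv L L' ->
  flip_equiv (L ++ h :: R) (L' ++ h :: R).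
Proof.
move=> H LL'; elim: LL' H => {L L'} [L L' f H|L H|L L' f IH H|L M N f IH g IH' H].
- exact/rst_step/flip_cat.
- exact: rst_refl.
- by apply/rst_sym/IH; rewrite (perm_all _ (flip_equiv_perm _ _ f)).
- apply: rst_trans (IH H) (IH' _).
  by rewrite -(perm_all _ (flip_equiv_perm _ _ f)).
Qed.

(** Reverse [L], then the whole word, which gives [rev R ++ h :: L], then undo the reversal of
    [R]. *)
Lemma flip_equiv_swap L h R :
  all (fun x => `|h|%N < `|x|%N) (L ++ R) ->
  flip_equiv (L ++ h :: R) (R ++ h :: L).
Proof.
rewrite all_cat => /andP[HL HR].
apply: rst_trans (flip_equiv_catl _ _ _ R HL (flip_equiv_rev L)) _.
apply: rst_trans (flip_equiv_rev _) _.
rewrite rev_cat rev_cons revK cat_rcons.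
apply: rst_sym; apply: flip_equiv_catl => //; exact: flip_equiv_rev.
Qed.

(** Flips act on prefixes, so [R] is swapped to the front, changed there and swapped back. *)
Lemma flip_equiv_cat L L' h R R' :
  all (fun x => `|h|%N < `|x|%N) (L ++ R) ->
  flip_equiv L L' -> flip_equiv R R' ->
  flip_equiv (L ++ h :: R) (L' ++ h :: R').
Proof.
rewrite all_cat => /andP[HL HR] LL' RR'.
have HL' : all (fun x => `|h|%N < `|x|%N) L'.
  by rewrite -(perm_all _ (flip_equiv_perm _ _ LL')).
have HR' : all (fun x => `|h|%N < `|x|%N) R'.
  by rewrite -(perm_all _ (flip_equiv_perm _ _ RR')).
apply: rst_trans (flip_equiv_catl _ _ _ R HL LL') _.
apply: rst_trans (flip_equiv_swap _ _ _ _) _; first by rewrite all_cat HL'.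
apply: rst_trans (flip_equiv_catl _ _ _ L' HR RR') _.
by apply: flip_equiv_swap; rewrite all_cat HR'.
Qed.

(* The empty word counts as having infinite least absolute value. *)
Definition precedes (u v : seq int) : bool :=
  (v == [::]) || (u != [::]) && (minabs u < minabs v).

(** Distinct absolute values exclude ties; two empty words would precede each other. *)
Lemma precedesC L R :
  uniq (abs_word (L ++ R)) -> L ++ R != [::] -> precedes R L = ~~ precedes L R.
Proof.
rewrite /abs_word map_cat cat_uniq => /and3P[_ /hasPn H _].
rewrite /precedes; case: L H => [|a L] H; case: R H => [|b R] H //= _.
have m1 := minabs_mem (isT : a :: L != [::]).
have /H m2 := minabs_mem (isT : b :: R != [::]).
by case: ltngtP m2 => //= ->; rewrite m1.
Qed.

Lemma perm_eq_nil (u v : seq int) : perm_eq u v -> (u == [::]) = (v == [::]).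
Proof. by move/perm_size; case: u; case: v. Qed.

Lemma precedes_perm u u' v v' :
  perm_eq u u' -> perm_eq v v' -> precedes u v = precedes u' v'.
Proof.
move=> pu pv; rewrite /precedes (minabs_perm pu) (minabs_perm pv).
by rewrite (perm_eq_nil _ _ pu) (perm_eq_nil _ _ pv).
Qed.

(** * The tree of a word and its invariance under flips *)

Definition tree_step (f : seq int -> btree) (L : seq int) (h : int)
    (R : seq int) : btree :=
  if (L ++ R == [::]) && ~~ (0 < h)%R then LabelledLeaf `|h|
  else if (0 < h)%R == precedes L R then Node `|h| (f L) (f R)
  else Node `|h| (f R) (f L).

(* [m] bounds the recursion depth. *)
Fixpoint tree_rec (m : nat) (w : seq int) : btree :=
  if m is m'.+1 then
    if w is [::] then EmptyLeaf else
    let i := imin w in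
    tree_step (tree_rec m') (take i w) (nth 0%R w i) (drop i.+1 w)
  else EmptyLeaf.

Definition tree_of (w : seq int) : btree := tree_rec (size w) w.

Lemma tree_step_eq f g L h R :
  f L = g L -> f R = g R -> tree_step f L h R = tree_step g L h R.
Proof. by rewrite /tree_step => -> ->. Qed.

Lemma tree_rec_fuel m m' w :
  size w <= m -> size w <= m' -> tree_rec m w = tree_rec m' w.
Proof.
elim: m m' w => [|m IH] [|m'] [|a w] //= sm sm'.
have lt := imin_lt (isT : a :: w != [::]).
apply: tree_step_eq; apply: IH;
  rewrite ?size_take ?size_drop /= in lt *; try case: ifP; move: lt sm sm'; lia.
Qed.

Lemma tree_of_cat L h R :
  all (fun x => `|h|%N < `|x|%N) (L ++ R) ->
  tree_of (L ++ h :: R) = tree_step tree_of L h R.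
Proof.
move=> H; rewrite {1}/tree_of size_cat addnS /=.
case e: (L ++ h :: R) => [|a w]; first by case: (L) e.
rewrite -{}e imin_cat //.
rewrite take_size_cat // nth_cat ltnn subnn /= -cat_rcons.
rewrite drop_size_cat ?size_rcons //.
by apply: tree_step_eq; apply: tree_rec_fuel; rewrite ?leq_addr ?leq_addl.
Qed.

(** Exchanging [L] and [R] negates [precedes], hence exchanges the two [Node] branches, unless both
    words are empty. *)
Lemma tree_stepC f L h R :
  uniq (abs_word (L ++ R)) -> tree_step f L h R = tree_step f R h L.
Proof.
move=> u; rewrite /tree_step.
have -> : (R ++ L == [::]) = (L ++ R == [::]).
  by apply/perm_eq_nil; rewrite perm_catC.
have [|n0] := eqVneq (L ++ R) [::].
  by case: (L) => //; case: (R) => //=; case: ifP.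
by rewrite (precedesC _ _ u n0) /=; case: (0 < h)%R; case: (precedes L R).
Qed.

(** The full reversal is absorbed by [tree_stepC], a flip inside [L] by induction; [precedes]
    ignores the order of letters. *)
Lemma tree_of_flip w :
  uniq (abs_word w) -> 0%R \notin w ->
  forall v, flip w v -> tree_of v = tree_of w.
Proof.
move: w; apply: minimal_letter_ind => [v [k [/= ]]|L h R u hn H IHL IHR v].
  by case: k.
(* The empty word has no flip, so its reversal is treated apart. *)
have Trev s : (forall v, flip s v -> tree_of v = tree_of s) ->
    tree_of (rev s) = tree_of s.
  by have [->//|sn0] := eqVneq s [::]; apply; apply: flip_rev.
case/flip_min_split => // [->|[L' LL' ->]].
  rewrite rev_cat rev_cons cat_rcons !tree_of_cat // -?rev_cat ?all_rev //.
  rewrite tree_stepC; last by rewrite -rev_cat /abs_word map_rev rev_uniq.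
  rewrite /tree_step (Trev _ IHL) (Trev _ IHR).
  have pL : perm_eq (rev L) L by rewrite perm_rev.
  have pR : perm_eq (rev R) R by rewrite perm_rev.
  rewrite (precedes_perm _ _ _ _ pL pR).
  suff -> : (rev L ++ rev R == [::]) = (L ++ R == [::]) by [].
  exact/perm_eq_nil/perm_cat.
have pL := perm_flip LL'.
have pLR : perm_eq (L ++ R) (L' ++ R) by rewrite perm_cat2r.
rewrite !tree_of_cat // -?(perm_all _ pLR) // /tree_step (IHL _ LL').
by rewrite -(perm_eq_nil _ _ pLR) (precedes_perm _ _ _ _ pL (perm_refl R)).
Qed.

Lemma tree_of_flip_equiv w v :
  uniq (abs_word w) -> 0%R \notin w -> flip_equiv w v -> tree_of v = tree_of w.
Proof.
move=> u n wv; elim: wv u n => {w v} [w v f u n|//|w v f IH u n|w v x f IHf g IHg u n].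
- exact: tree_of_flip.
- by rewrite IH //; have p := flip_equiv_perm _ _ f;
    rewrite ?(perm_uniq (perm_map absz p)) ?(perm_mem p).
- by rewrite IHg ?IHf //; have p := flip_equiv_perm _ _ f;
    rewrite -?(perm_uniq (perm_map absz p)) -?(perm_mem p).
Qed.

Lemma tree_of_increasing w :
  uniq (abs_word w) -> 0%R \notin w ->
  perm_eq (labels (tree_of w)) (abs_word w) /\ increasing (tree_of w).
Proof.
move: w; apply: minimal_letter_ind => // L h R u hn H [pL iL] [pR iR].
have pLR := perm_cat pL pR; rewrite -map_cat in pLR.
have aLR : all (ltn `|h|%N) (labels (tree_of L) ++ labels (tree_of R)).
  by rewrite (perm_all _ pLR) all_map.
have pw : perm_eq (`|h|%N :: abs_word (L ++ R)) (abs_word (L ++ h :: R)).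
  by rewrite /abs_word !map_cat /= -cat1s perm_catCA.
rewrite tree_of_cat // /tree_step -(permPr pw).
case: ifP => [/andP[/eqP -> _] //|_].
case: ifP => _ /=; rewrite iL iR perm_cons.
  by rewrite pLR [all _ _]aLR.
by rewrite perm_catC pLR (perm_all _ (permEl (perm_catC _ _))) [all _ _]aLR.
Qed.

(** * Reading a word off a tree *)

(** The labels are read in symmetric order; each sign is the one for which [tree_step] keeps the two
    sides in place. *)
Fixpoint word_of (t : btree) : seq int :=
  match t with
  | EmptyLeaf => [::]
  | LabelledLeaf a => [:: (- a%:Z)%R]
  | Node a l r =>
    word_of l ++
    (if precedes (word_of l) (word_of r) then a%:Z%R else (- a%:Z)%R) ::
    word_of r
  end.

Lemma perm_abs_word_of t : perm_eq (abs_word (word_of t)) (labels t).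
Proof.
elim: t => [//|a|a l IHl r IHr] /=; first by rewrite abszN.
rewrite /abs_word map_cat /= -cat1s perm_catCA /=.
have -> : `|if precedes (word_of l) (word_of r) then a%:Z%R else (- a%:Z)%R|%N = a.
  by case: ifP => _; rewrite ?abszN.
by rewrite perm_cons perm_cat.
Qed.

Lemma word_ofK t :
  increasing t -> 0 \notin labels t -> tree_of (word_of t) = t.
Proof.
elim: t => [//|a|a l IHl r IHr] /=.
  rewrite inE => _ a0; rewrite (tree_of_cat [::] _ [::]) // /tree_step /=.
  by rewrite abszN oppr_gt0.
rewrite inE mem_cat !negb_or => /and3P[al il ir] /and3P[a0 l0 r0].
set L := word_of l; set R := word_of r.
set h : int := if precedes L R then _ else _.
have ah : `|h|%N = a by rewrite /h; case: ifP => _; rewrite ?abszN.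
have hs : (0 < h)%R = precedes L R.
  by rewrite /h; case: ifP => _; move: a0; lia.
rewrite tree_of_cat; last first.
  have : all (ltn a) (abs_word (L ++ R)).
    have p := perm_cat (perm_abs_word_of l) (perm_abs_word_of r).
    by rewrite /abs_word map_cat (perm_all _ p).
  by rewrite all_map ah.
rewrite /tree_step hs eqxx ah IHl // IHr //.
(* Not a labelled leaf: two empty sides satisfy [precedes], which makes [h] positive. *)
case: ifP => // /andP[/eqP]; rewrite /precedes.
by case: (L) => //; case: (R).
Qed.

(** Reading the tree back restores every sign and at most swaps the two sides of a letter, which
    flips can do. Hence the tree determines the class. *)
Lemma flip_equiv_word_tree w :
  uniq (abs_word w) -> 0%R \notin w -> flip_equiv w (word_of (tree_of w)).
Proof.
move: w; apply: minimal_letter_ind => [|L h R u hn H IHL IHR].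
  exact: rst_refl.
have S (b : bool) : (0 < h)%R = b ->
    (if b then `|h|%N%:Z%R else (- `|h|%N%:Z)%R) = h by move=> <-; case: ifP; lia.
have pL := flip_equiv_perm _ _ IHL; have pR := flip_equiv_perm _ _ IHR.
rewrite tree_of_cat // /tree_step; case: ifP => [/andP[/eqP e hneg]|ne].
  move: e; case: (L) => //; case: (R) => //= _.
  by rewrite (S false) //; [apply: rst_refl | apply: negbTE].
case: ifP => [/eqP e|/eqP/eqP e] /=.
  rewrite -(precedes_perm _ _ _ _ pL pR) S //.
  exact: flip_equiv_cat.
(* Two empty sides were settled by the earlier branches, so [precedesC] applies. *)
have n0 : L ++ R != [::].
  apply/eqP => e0; move: e ne; rewrite e0.
  by move: e0; case: (L) => //; case: (R) => //= _; case: (0 < h)%R.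
rewrite -(precedes_perm _ _ _ _ pR pL) S.
  apply: rst_trans (flip_equiv_swap _ _ _ H) _.
  by apply: flip_equiv_cat => //; rewrite all_cat andbC -all_cat.
by rewrite (precedesC _ _ u n0); case: (0 < h)%R e; case: precedes.
Qed.

(** * The rightmost label and the signed maximum *)

(* The third clause is what makes the rightmost label survive when the tree is
   hung as a right subtree. *)
Definition rightmost_spec (t : btree) (s : int) : Prop :=
  [/\ s != 0%R,
      if (0 < s)%R then v_last t = None /\ v_penultimate t = Some `|s|%N
      else v_last t = Some `|s|%N & t <> EmptyLeaf].

Lemma rightmost_spec_node a l r s :
  rightmost_spec r s -> rightmost_spec (Node a l r) s.
Proof.
rewrite /rightmost_spec /v_last /v_penultimate.
case: r => [|b|b l' r'] [s0 + r0] //; last first.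
  by move: s0; case: r' => [|c|c l'' r''] in r0 * => s0 p; split.
(* A labelled leaf has no penultimate vertex, but its [v_last] excludes a positive [s]. *)
by case: ifP => s1 [] // e; split; rewrite ?s1 // /v_last e.
Qed.

(** Where [smax] stops at [h], the tree is a labelled leaf or has an empty right subtree; otherwise
    [smax] recurses into the word of the right subtree. *)
Lemma rightmost_spec_tree_of w :
  uniq (abs_word w) -> 0%R \notin w -> w != [::] ->
  rightmost_spec (tree_of w) (smax w).
Proof.
move: w; apply: minimal_letter_ind => // L h R u hn H IHL IHR _.
rewrite tree_of_cat // smax_cat //.
have := precedesC L R u.
rewrite /tree_step /smax_step /precedes.
case: L IHL {u H} => [|a L] IHL; case: R IHR => [|b R] IHR //=.
- move=> _; case: ifP => [/negbTE hneg|/negbFE hpos].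
    by split; rewrite ?hneg.
  by rewrite hpos; split; rewrite ?hpos.
- move=> _; case h0: (0 < h)%R; first by split; rewrite ?h0.
  exact/rightmost_spec_node/IHR.
- move=> _; case h0: (0 < h)%R; first by split; rewrite ?h0.
  exact/rightmost_spec_node/IHL.
- move/(_ isT) => ->.
  by case: (0 < h)%R; case: (minabs (a :: L) < _) => /=;
    apply/rightmost_spec_node; [exact: IHR|exact: IHL|exact: IHL|exact: IHR].
Qed.

(** * Passage to flip classes *)

Lemma signed_perm_uniq n w : signed_perm n w -> uniq (abs_word w).
Proof. by move/perm_uniq => ->; apply: iota_uniq. Qed.

Lemma signed_perm_neq0 n w : signed_perm n w -> 0%R \notin w.
Proof.
move=> p; apply/negP => /(map_f absz).
by rewrite -/(abs_word w) (perm_mem p) mem_iota.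
Qed.

Lemma signed_perm_neq_nil n w : 1 <= n -> signed_perm n w -> w != [::].
Proof.
move=> n1 /perm_size; rewrite size_map size_iota => sw.
by apply: contraTneq n1 => w0; rewrite -sw w0.
Qed.

(** [xget] chooses a representative; its default [[::]] never matters, flip classes being
    nonempty. *)
Definition class_tree (C : set (seq int)) : btree := tree_of (xget [::] C).

Lemma class_treeE n w : signed_perm n w -> class_tree (flip_class w) = tree_of w.
Proof.
move=> p; apply: tree_of_flip_equiv.
- exact: signed_perm_uniq p.
- exact: signed_perm_neq0 p.
- exact: (xgetPex [::] (ex_intro (flip_class w) w (rst_refl _ _ w))).
Qed.

Lemma tree_of_eq_flip_class n w v :
  signed_perm n w -> signed_perm n v -> tree_of w = tree_of v ->
  flip_class w = flip_class v.
Proof.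
move=> pw pv e.
have ww := flip_equiv_word_tree w (signed_perm_uniq _ _ pw) (signed_perm_neq0 _ _ pw).
have vv := flip_equiv_word_tree v (signed_perm_uniq _ _ pv) (signed_perm_neq0 _ _ pv).
have wv : flip_equiv w v by apply: rst_trans ww _; rewrite e; apply: rst_sym.
apply/seteqP; split=> x; last exact: rst_trans.
exact/rst_trans/rst_sym.
Qed.

(** Common to all the bijections wanted: on signed permutations, [P] is the preimage of [T] under
    [tree_of]. Surjectivity uses [word_of]. *)
Lemma class_tree_bij n (P : set (seq int)) (T : set btree) :
  P `<=` signed_perm n ->
  (forall w, P w -> T (tree_of w)) ->
  (forall t, T t -> Tree n t) ->
  (forall w, signed_perm n w -> T (tree_of w) -> P w) ->
  set_bij [set flip_class w | w in P] T class_tree.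
Proof.
move=> PS PT TT TP; split.
- by move=> _ [w Pw <-]; rewrite (class_treeE n) //; [apply: PT|apply: PS].
- move=> C D /set_mem[w Pw <-] /set_mem[v Pv <-].
  rewrite !(class_treeE n); try exact: PS.
  by apply: (tree_of_eq_flip_class n); apply: PS.
- move=> t Tt; have [pt it] := TT _ Tt.
  have pw : signed_perm n (word_of t).
    exact: perm_trans (perm_abs_word_of t) pt.
  have e : tree_of (word_of t) = t.
    by apply: word_ofK => //; rewrite (perm_mem pt) mem_iota.
  exists (flip_class (word_of t)); last by rewrite (class_treeE n).
  by exists (word_of t) => //; apply: TP => //; rewrite e.
Qed.

Lemma tree_of_Tree n w : signed_perm n w -> Tree n (tree_of w).
Proof.
move=> pw.
have [p i] := tree_of_increasing w (signed_perm_uniq _ _ pw) (signed_perm_neq0 _ _ pw).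
by split=> //; apply: perm_trans p pw.
Qed.

Theorem theorem7p1 (n : nat) (n_ge1 : 1 <= n) :
  exists phi : set (seq int) -> btree,
    set_bij (FLB n `|` FLD n) (Tcirc n `|` Tstar n) phi /\
    (forall k : nat, 1 <= k <= n ->
       set_bij (FLBk n k) (Tcirck n k) phi /\
       set_bij (FLDk n k) (Tstark n k) phi).
Proof.
have spec w : signed_perm n w -> rightmost_spec (tree_of w) (smax w).
  move=> p; apply: rightmost_spec_tree_of.
  - exact: signed_perm_uniq p.
  - exact: signed_perm_neq0 p.
  - exact: signed_perm_neq_nil n_ge1 p.
have treeP := tree_of_Tree n.
exists class_tree; split; [|move=> k /andP[k1 _]; split].
- rewrite /FLB /FLD -image_setU; apply: (class_tree_bij n) => //.
  + by move=> w [] [].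
  + move=> w Pw; have sw : signed_perm n w by case: Pw => -[].
    have [_ + _] := spec w sw; have tw := treeP w sw.
    case: ifP => [_ [vl _]|_ vl]; first by left.
    by right; split=> //; eexists; exact: vl.
  + by move=> t [] [].
  (* The signed maximum is nonzero, so one of the two signs occurs. *)
  + move=> w sw _; have [s0 _ _] := spec w sw.
    by case: ltrgt0P s0 => // s _; [left | right].
- apply: (class_tree_bij n) => //.
  + by move=> w [].
  + move=> w [sw e]; have [_ + _] := spec w sw; have tw := treeP w sw.
    by rewrite e ltz_nat k1 => -[vl vp]; split; [split|].
  + by move=> t [] [].
  + move=> w sw [[_ vl] vp]; have [_ + _] := spec w sw.
    (* An empty last leaf forces a positive maximum, and the penultimate label gives its value. *)
    rewrite /= in vl vp; rewrite vl vp; case: ifP => // s0 [_ [e]].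
    by split=> //; lia.
- apply: (class_tree_bij n) => //.
  + by move=> w [].
  + move=> w [sw e]; have [_ + _] := spec w sw; have tw := treeP w sw.
    rewrite e oppr_gt0 abszN /= => vl.
    by split=> //; split=> //; exists k.
  + by move=> t [] [].
  + move=> w sw [_ vl]; have [s1 + _] := spec w sw.
    rewrite /= in vl; rewrite vl; case: ifP => [_ [] //|s0 [e]].
    by split=> //; lia.
Qed.
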